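(* Let $G=(V,E)$ be a hypergraph with $G=\mathrm{cl}(G)$, and let $C=e_1,e_2,e_3,e_1$ be an $\alpha$-cycle of $G$ satisfying $$e_1\setminus(e_2\cup e_3)=\emptyset,\quad e_2\setminus(e_1\cup e_3)=\emptyset,\quad e_3\setminus(e_1\cup e_2)=\emptyset.$$ Then all switchings of the inequalities \begin{align*} & z_{e_1}+z_{e_2}\le z_{e_1\cap e_2}+z_{e_3},\\ & z_{e_1}+z_{e_3}\le z_{e_1\cap e_3}+z_{e_2},\\ & z_{e_2}+z_{e_3}\le z_{e_2\cap e_3}+z_{e_1},\\ & z_{e_1\cap e_2}+z_{e_1\cap e_3}+z_{e_2\cap e_3}-z_{e_1}-z_{e_2}-z_{e_3}\le z_{e_1\cap e_2\cap e_3} \end{align*} (where $z_\emptyset:=1$ and $z_{\{v\}}:=z_v$) are Chvátal–Gomory cuts for the complete edge relaxation $\mathrm{CER}(G)$.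
   Context: A hypergraph $G=(V,E)$ consists of a finite set $V$ of nodes and a set $E$ of subsets of $V$ of cardinality at least two, called edges. Its completion is $\mathrm{cl}(G)=(V,\mathrm{cl}(E))$ with $\mathrm{cl}(E):=\{f:|f|\ge2,\ f\subseteq e\text{ for some }e\in E\}$. An edge is maximal if it is not contained in any other edge; $E_{\max}$ is the set of maximal edges. For $e\in E_{\max}$ and $U\subseteq e$ let $$\psi(U,e):=\sum_{W\subseteq U,\ |W|\text{ even}} z_{(e\setminus U)\cup W}-\sum_{W\subseteq U,\ |W|\text{ odd}} z_{(e\setminus U)\cup W},$$ with $z_\emptyset:=1$, $z_{\{v\}}:=z_v$. The complete edge relaxation is $\mathrm{CER}(G):=\{z\in\mathbb{R}^{V\cup\mathrm{cl}(E)}:\psi(U,e)\ge0\ \forall U\subseteq e,\ \forall e\in E_{\max}\}$. An $\alpha$-cycle of $G$ of length $\ell\ge3$ is a sequence $C=e_1,\dots,e_\ell,e_{\ell+1}$ of edges with $e_{\ell+1}=e_1$ such that, with $s_i:=e_i\cap e_{i+1}$ for $i\in\{1,\dots,\ell\}$: (1) $e_i\setminus e_j\ne\emptyset$ for all $i\neq j\in\{1,\dots,\ell\}$; (2) $(s_{i-1}\cup s_i\cup s_{i+1})\setminus e\neq\emptyset$ for all $i\in\{1,\dots,\ell\}$ and all $e\in E$, with indices modulo $\ell$. Switching: for $G=\mathrm{cl}(G)$ and $U\subseteq V$, let $\phi_U$ be the affine map of $\mathbb{R}^{V\cup E}$ given by $\phi_U(z_v)=1-z_v$ if $v\in U$,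 $\phi_U(z_v)=z_v$ if $v\in V\setminus U$, and for $e\in E$ $$\phi_U(z_e)=\sum_{W\subseteq e\cap U,\ |W|\text{ even}}z_{(e\setminus U)\cup W}-\sum_{W\subseteq e\cap U,\ |W|\text{ odd}}z_{(e\setminus U)\cup W}.$$ The $U$-switching of a linear inequality $az\le\beta$ is its image under $\phi_U$, i.e. the inequality obtained by replacing each variable $z_p$ by $\phi_U(z_p)$ (constants moved to the right-hand side). ''All switchings'' means the $U$-switchings for all $U\subseteq V$. A Chvátal–Gomory (CG) cut for a polyhedron $P$ is an inequality $az\le\lfloor\beta\rfloor$ where $a$ is an integral vector, $\beta\in\mathbb{R}$, and $az\le\beta$ is valid for $P$. *)

(* Defs.v *)
From HB Require Import structures.
From mathcomp Require Import all_boot all_order all_algebra reals.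

Set Implicit Arguments.
Unset Strict Implicit.
Unset Printing Implicit Defensive.

Import Order.TTheory GRing.Theory Num.Theory.
Local Open Scope ring_scope.

Section Hypergraphs.

Variable V : finType.
Implicit Types (E : {set {set V}}) (e f U W : {set V}).

(* The node set is the whole type V, so a hypergraph is given by its edges. *)
Definition hypergraph E : Prop := forall e, e \in E -> (2 <= #|e|)%N.

Definition cl E : {set {set V}} :=
  [set f : {set V} | (2 <= #|f|)%N && [exists e in E, f \subset e]].

Definition Emax E : {set {set V}} :=
  [set e in E | [forall f in E, ~~ (e \proper f)]].

(* The closing edge e_(l+1) = e_1 is left implicit: ordS and ord_pred are
   the successor and the predecessor modulo l. *)
Definition cap_next l (C : l.-tuple {set V}) (i : 'I_l) : {set V} :=
  tnth C i :&: tnth C (ordS i).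

Definition alpha_cycle E l (C : l.-tuple {set V}) : Prop :=
  [/\ (3 <= l)%N,
      forall i : 'I_l, tnth C i \in E,
      forall i j : 'I_l, i != j -> tnth C i :\: tnth C j != set0
    & forall (i : 'I_l) e, e \in E ->
        (cap_next C (ord_pred i) :|: cap_next C i :|: cap_next C (ordS i))
          :\: e != set0].

End Hypergraphs.

Section Inequalities.

Variables (R : realType) (V : finType) (E : {set {set V}}).

(* Coordinates of R^(V u cl(E)), which is R^(V u E) when E = cl E. *)
Definition coord := (V + {e : {set V} | e \in cl E})%type.

Definition point := {ffun coord -> R}.

(* (a, c) stands for the affine form z |-> a z + c on the space of points. *)
Definition affine := ({ffun coord -> R} * R)%type.

Definition dot (a : {ffun coord -> R}) (z : point) : R :=
  \sum_(p : coord) a p * z p.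

Definition eval (f : affine) (z : point) : R := dot f.1 z + f.2.

Definition acst (c : R) : affine := ([ffun=> 0], c).

Definition avar (p : coord) : affine := ([ffun q => (q == p)%:R], 0).

(* The form z_p for a set of nodes p, with z_set0 = 1 and z_[set v] = z_v.
   It is meant for p empty, a singleton or in cl E; the value 0 on the
   remaining sets is arbitrary. *)
Definition zform (p : {set V}) : affine :=
  if p == set0 then acst 1
  else if [pick v | p == [set v]] is Some v then avar (inl v)
  else if insub p is Some e then avar (inr e)
  else 0.

Definition altsum (A B : {set V}) : affine :=
  \sum_(W : {set V} | (W \subset B) && ~~ odd #|W|) zform (A :|: W)
  - \sum_(W : {set V} | (W \subset B) && odd #|W|) zform (A :|: W).

Definition psi (U e : {set V}) : affine := altsum (e :\: U) U.

Definition CER (z : point) : Prop :=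
  forall e U : {set V}, e \in Emax E -> U \subset e -> 0 <= eval (psi U e) z.

Record ineq := Ineq { lhs : {ffun coord -> R}; rhs : R }.

(* f <= g, with the variables moved to the left and the constants to the
   right. *)
Definition ineq_of (f g : affine) : ineq := Ineq (f.1 - g.1) (g.2 - f.2).

(* phi U p is the affine form substituted for the variable z_p; switching
   collects linear parts on the left and constants on the right. *)
Definition phi (U : {set V}) (p : coord) : affine :=
  match p with
  | inl v => if v \in U then acst 1 - avar (inl v) else avar (inl v)
  | inr e => altsum (val e :\: U) (val e :&: U)
  end.

Definition switching (U : {set V}) (I : ineq) : ineq :=
  Ineq [ffun q => \sum_(p : coord) lhs I p * (phi U p).1 q]
       (rhs I - \sum_(p : coord) lhs I p * (phi U p).2).

Definition CG_cut (P : point -> Prop) (I : ineq) : Prop :=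
  (forall p : coord, lhs I p \is a Num.int) /\
  exists beta : R, rhs I = (Num.floor beta)%:~R /\
    forall z : point, P z -> dot (lhs I) z <= beta.

End Inequalities.

(* Main.v *)
Require Import Defs.
From HB Require Import structures.
From mathcomp Require Import all_boot all_order all_algebra reals.
From mathcomp Require Import lra.

Set Implicit Arguments.
Unset Strict Implicit.
Unset Printing Implicit Defensive.

Import Order.TTheory GRing.Theory Num.Theory.
Local Open Scope ring_scope.

(* A point of CER(G) restricts, below every maximal edge e, to the moments of
   a nonnegative measure on the subsets S of e (Moebius inversion); hence
   p |-> z_p is decreasing and supermodular below each edge. Adding such
   inequalities bounds twice the excess of each of the four inequalities by
   z_(e1 :&: e2 :&: e3) <= 1, so the excess is at most 1/2 and rounds down to 0.
   Switching maps CER(G) into itself and has integral coefficients, hence it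
   preserves Chvatal-Gomory cuts. *)

(** * Signed subset sums, switching and Möbius inversion *)

Section SignedSums.

Variables (R : realType) (V : finType).
Implicit Types (m : {set V} -> R) (A B U e : {set V}) (v : V).

(** If [m p] is the mass of the sets containing [p] under some measure, inclusion-exclusion makes
    this the mass of the sets that contain [A] and avoid [B]. *)
Definition signed_sum m A B : R :=
  \sum_(W : {set V} | W \subset B) (-1) ^+ #|W| * m (A :|: W).

Lemma eq_signed_sum m1 m2 A B :
  (forall p : {set V}, p \subset A :|: B -> m1 p = m2 p) ->
  signed_sum m1 A B = signed_sum m2 A B.
Proof. by move=> eq_m; apply: eq_bigr => W sWB; rewrite eq_m // setUS. Qed.

Lemma sum_subsetU1 (F : {set V} -> R) v B : v \notin B ->
  \sum_(W : {set V} | W \subset v |: B) F W =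
  \sum_(W : {set V} | W \subset B) F W +
  \sum_(W : {set V} | W \subset B) F (v |: W).
Proof.
move=> vB; rewrite (bigID (fun W : {set V} => v \in W)) /= addrC.
congr (_ + _).
  by apply: eq_bigl => W; rewrite -subsetD1 setU1K.
rewrite (reindex_onto (fun W => v |: W) (fun W => W :\ v)) /=.
  apply: eq_bigl => W; rewrite setU11 andbT.
  apply/andP/idP => [[sW /eqP <-]|sW]; first by rewrite subDset.
  by rewrite setUS // setU1K // (contra (subsetP sW v)).
by move=> W /andP[_ vW]; rewrite setD1K.
Qed.

Lemma signed_sum0 m A : signed_sum m A set0 = m A.
Proof.
rewrite /signed_sum (big_pred1 set0); last by move=> W; rewrite subset0.
by rewrite cards0 expr0 mul1r setU0.
Qed.

(** Among the sets that contain [A] and avoid [B], those avoiding [v] remain once those containing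
    [v] are removed. The inductions below run on this recursion. *)
Lemma signed_sumU1 m A B v : v \notin B ->
  signed_sum m A (v |: B) = signed_sum m A B - signed_sum m (v |: A) B.
Proof.
move=> vB; rewrite /signed_sum sum_subsetU1 //; congr (_ + _).
rewrite -sumrN; apply: eq_bigr => W sWB.
rewrite cardsU1 (contra (subsetP sWB v)) //= exprS mulN1r mulNr.
by rewrite setUCA setUA.
Qed.


Lemma finset_ind (P : {set V} -> Prop) :
  P set0 -> (forall v B, v \notin B -> P B -> P (v |: B)) -> forall B, P B.
Proof.
move=> P0 PU B; have [n] := ubnP #|B|; elim: n B => // n IHn B leBn.
have [->|[v vB]] := set_0Vmem B; first exact: P0.
rewrite -(setD1K vB); apply: PU; first by rewrite !inE eqxx.
by apply: IHn; move: leBn; rewrite (cardsD1 v B) vB.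
Qed.

Lemma disjoint_setU1 v A B :
  [disjoint v |: A & B] = (v \notin B) && [disjoint A & B].
Proof. by rewrite !disjoints_subset subUset sub1set inE. Qed.

(** Switching transports the measure along symmetric difference with [U], so the nodes of [U] trade
    places between the contained and the avoided side. *)
Lemma signed_sum_switch m U A B : [disjoint A & B] ->
  signed_sum (fun p => signed_sum m (p :\: U) (p :&: U)) A B =
  signed_sum m ((A :\: U) :|: (B :&: U)) ((B :\: U) :|: (A :&: U)).
Proof.
elim/finset_ind: B A => [A _|v B vB IH A].
  by rewrite signed_sum0 set0I set0D setU0 set0U.
rewrite disjoint_sym disjoint_setU1 disjoint_sym => /andP[vA dAB].
have dvAB : [disjoint v |: A & B] by rewrite disjoint_setU1 vB.
rewrite signed_sumU1 // !IH // !(setDUl, setIUl).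
have [vU|vU] := boolP (v \in U).
  have -> : [set v] :&: U = [set v] by apply/setIidPl; rewrite sub1set.
  have -> : [set v] :\: U = set0 by apply/eqP; rewrite setD_eq0 sub1set.
  (* For [v] in [U], the subtracted term has [v] on the avoided side. Expanding it by the recursion
     cancels the first term and leaves [v] on the contained side. *)
  rewrite !set0U [X in _ - signed_sum _ _ X]setUCA signed_sumU1.
    by rewrite opprB addrC subrK setUCA.
  by rewrite !inE negb_or negb_and vU vB (negPf vA).
have -> : [set v] :&: U = set0.
  by apply/eqP; rewrite setI_eq0 disjoints1.
have -> : [set v] :\: U = [set v] by apply/setDidPl; rewrite disjoints1.
rewrite !set0U -!setUA signed_sumU1 //.
by rewrite !inE negb_or !negb_and vU vB (negPf vA).
Qed.

(** The terms on the right are the masses of the single sets [S]. Induction on the number of nodes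
    of [e] outside [A] and [B]: each such node is put on either side, and when none is left only
    [S = A] remains. *)
Lemma signed_sum_moebius m e A B :
    [disjoint A & B] -> A :|: B \subset e ->
  signed_sum m A B =
  \sum_(S : {set V} | (A \subset S) && (S \subset e :\: B))
     signed_sum m S (e :\: S).
Proof.
have [n] := ubnP #|e :\: (A :|: B)|; elim: n A B => // n IHn A B leBn dAB sABe.
have [eAB|[v]] := set_0Vmem (e :\: (A :|: B)).
  have eE : e = A :|: B.
    by apply/eqP; rewrite eqEsubset sABe andbT -setD_eq0 eAB.
  have eDB : e :\: B = A by rewrite eE setDUl setDv setU0; apply/setDidPl.
  have eDA : e :\: A = B.
    rewrite eE setDUl setDv set0U; apply/setDidPl.
    by rewrite disjoint_sym.
  rewrite (big_pred1 A) ?eDA // => S.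
  by rewrite eDB -eqEsubset eq_sym.
rewrite !inE negb_or => /andP[/andP[vA vB] ve].
have lt_n (C : {set V}) : A :|: B \subset C -> v \in C -> (#|e :\: C| < n)%N.
  move=> sC vC; rewrite -ltnS (leq_trans _ leBn) // ltnS; apply: proper_card.
  apply/properP; split; first exact: setDS.
  by exists v; rewrite !inE ?ve ?vC // negb_or vA vB.
transitivity (signed_sum m A (v |: B) + signed_sum m (v |: A) B).
  by rewrite signed_sumU1 // subrK.
rewrite !IHn.
- rewrite [RHS](bigID (fun S : {set V} => v \notin S)) /=.
  congr (_ + _); apply: eq_bigl => S.
    by rewrite (setUC [set v]) -setDDl subsetD1 andbA.
  by rewrite negbK subUset sub1set -andbA andbC.
- by apply: lt_n; rewrite -setUA ?subsetUr ?setU11.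
- by rewrite disjoint_setU1 vB.
- by rewrite -setUA subUset sub1set ve.
- by apply: lt_n; rewrite ?setUS ?subsetUr // !inE eqxx orbT.
- by rewrite disjoint_sym disjoint_setU1 disjoint_sym vA.
- by rewrite setUCA subUset sub1set ve.
Qed.

End SignedSums.

(** * Moments of a nonnegative measure on the subsets of an edge *)

Section LocalMeasure.

Variables (R : realType) (V : finType) (m : {set V} -> R) (e : {set V}).
Hypothesis m_ge0 :
  forall S : {set V}, S \subset e -> 0 <= signed_sum m S (e :\: S).
Implicit Types (A B S X Y : {set V}).

Lemma signed_sum_ge0 A B :
  [disjoint A & B] -> A :|: B \subset e -> 0 <= signed_sum m A B.
Proof.
move=> dAB sABe; rewrite (signed_sum_moebius m dAB sABe); apply: sumr_ge0 => S.
by rewrite subsetD => /andP[_ /andP[sSe _]]; apply: m_ge0.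
Qed.

(** The indicator, in place of a restricted range, reduces inequalities between moments to
    inequalities between 0/1 coefficients of the same nonnegative masses. *)
Lemma moment_sum X : X \subset e ->
  m X = \sum_(S : {set V} | S \subset e)
          signed_sum m S (e :\: S) * (X \subset S)%:R.
Proof.
move=> sXe; rewrite -(signed_sum0 m X) (@signed_sum_moebius _ _ m e) ?setU0 //.
  rewrite setD0 big_mkcondl; apply: eq_bigr => S _.
  by case: (X \subset S); rewrite ?mulr1 ?mulr0.
by rewrite disjoint_sym disjoints_subset sub0set.
Qed.

Lemma moment_anti X Y : X \subset Y -> Y \subset e -> m Y <= m X.
Proof.
move=> sXY sYe; rewrite !moment_sum ?(subset_trans sXY) //.
apply: ler_sum => S sSe; rewrite ler_wpM2l ?m_ge0 // ler_nat.
by have [sYS|] := boolP (Y \subset S); rewrite // (subset_trans sXY).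
Qed.

(** For each [S]: if it contains both [X] and [Y] it contains their union and intersection, and if
    it contains just one of them it still contains the intersection. *)
Lemma moment_supermod X Y : X \subset e -> Y \subset e ->
  m X + m Y <= m (X :&: Y) + m (X :|: Y).
Proof.
move=> sXe sYe; rewrite !moment_sum ?subUset ?sXe // ?subIset ?sXe //.
rewrite -!big_split; apply: ler_sum => S sSe.
rewrite /= -!mulrDr ler_wpM2l ?m_ge0 // -!natrD ler_nat subUset.
have [sXS|_] := boolP (X \subset S).
  by rewrite subIset ?sXS //; case: (Y \subset S).
by have [sYS|_] := boolP (Y \subset S); rewrite // subIset ?sYS // orbT.
Qed.

End LocalMeasure.

(** * Evaluation of affine forms and switching of points *)

Section AffineForms.

Variables (R : realType) (V : finType) (E : {set {set V}}).
Implicit Types (f g : affine R E) (z : point R E) (A B S U : {set V}).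

Lemma evalD f g z : eval (f + g) z = eval f z + eval g z.
Proof.
rewrite /eval /dot addrACA -big_split; congr (_ + _).
by apply: eq_bigr => p _; rewrite ffunE mulrDl.
Qed.

Lemma evalN f z : eval (- f) z = - eval f z.
Proof.
rewrite /eval /dot opprD -sumrN; congr (_ + _).
by apply: eq_bigr => p _; rewrite ffunE mulNr.
Qed.

Lemma eval_acst c z : eval (acst E c) z = c.
Proof. by rewrite /eval /dot big1 ?add0r // => p _; rewrite ffunE mul0r. Qed.

Lemma eval_avar p z : eval (avar R p) z = z p.
Proof.
rewrite /eval /dot addr0 (bigD1 p) //= ffunE eqxx mul1r big1 ?addr0 //.
by move=> q /negPf qp; rewrite ffunE qp mul0r.
Qed.

Lemma eval_sum (I : finType) (P : pred I) (F : I -> affine R E) z :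
  eval (\sum_(i | P i) F i) z = \sum_(i | P i) eval (F i) z.
Proof.
apply: (big_ind2 (fun f r => eval f z = r)) => [|f1 r1 f2 r2 <- <-|//].
  exact: (eval_acst 0).
exact: evalD.
Qed.

Definition zval z (p : {set V}) : R := eval (zform R E p) z.

Lemma eval_altsum A B z : eval (altsum R E A B) z = signed_sum (zval z) A B.
Proof.
rewrite evalD evalN !eval_sum [RHS](bigID (fun W : {set V} => ~~ odd #|W|)) /=.
rewrite -sumrN; congr (_ + _); apply: eq_big => // W.
- by case/andP=> _ /negPf oW; rewrite -signr_odd oW mul1r.
- by rewrite negbK.
- by case/andP=> _ oW; rewrite -signr_odd oW mulN1r.
Qed.

Lemma zform0 : zform R E set0 = acst E 1.
Proof. by rewrite /zform eqxx. Qed.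

Lemma zform1 v : zform R E [set v] = avar R (inl v).
Proof.
rewrite /zform (negPf (_ : [set v] != set0)); last first.
  by apply/set0Pn; exists v; rewrite set11.
case: pickP => [w /eqP/set1_inj->|/(_ v)] //; by rewrite eqxx.
Qed.

Lemma zform_cl (e : {e : {set V} | e \in cl E}) :
  zform R E (val e) = avar R (inr e).
Proof.
have e2 : (2 <= #|val e|)%N by have := valP e; rewrite inE => /andP[].
rewrite /zform; case: eqP => [e0|_]; first by rewrite e0 cards0 in e2.
case: pickP => [w /eqP ew|_]; first by rewrite ew cards1 in e2.
by rewrite valK.
Qed.

(** Substituting [phi] into a form and evaluating at [z] is the same as evaluating the form here, so
    switching acts on points. *)
Definition switch_point U z : point R E := [ffun p => eval (phi R U p) z].

(** Lying below an edge forces [p] to be empty, a singleton or in [cl E], so the default value of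
    [zform] never occurs. *)
Lemma zval_switch U z (p e : {set V}) : p \subset e -> e \in E ->
  zval (switch_point U z) p = signed_sum (zval z) (p :\: U) (p :&: U).
Proof.
move=> spe eE; have [->|[v pv]] := set_0Vmem p.
  by rewrite set0D set0I signed_sum0 /zval zform0 !eval_acst.
have [p2|p2] := leqP 2 #|p|.
  have pcl : p \in cl E by rewrite inE p2; apply/existsP; exists e; rewrite eE.
  rewrite /zval -[p]/(val (exist (fun p => p \in cl E) p pcl)) zform_cl.
  by rewrite eval_avar ffunE eval_altsum.
have -> : p = [set v].
  by apply/eqP; rewrite eq_sym eqEcard sub1set pv cards1.
rewrite /zval zform1 eval_avar ffunE /=; case: ifP => vU.
  have -> : [set v] :&: U = v |: set0.
    by rewrite setU0; apply/setIidPl; rewrite sub1set.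
  have -> : [set v] :\: U = set0 by apply/eqP; rewrite setD_eq0 sub1set.
  rewrite signed_sumU1 ?inE // !signed_sum0 setU0 evalD evalN.
  by rewrite zform0 zform1.
have -> : [set v] :&: U = set0.
  by apply/eqP; rewrite setI_eq0 disjoints1 vU.
have -> : [set v] :\: U = [set v] by apply/setDidPl; rewrite disjoints1 vU.
by rewrite signed_sum0 zform1.
Qed.

(** [CER] constrains maximal edges only; this carries its consequences down to every edge. *)
Lemma Emax_above e : e \in E -> exists2 f, f \in Emax E & e \subset f.
Proof.
move=> eE; have [f /maxsetP[fE fmax] sef] := @maxset_exists _ [in E] e eE.
exists f => //; rewrite inE fE; apply/forall_inP => g gE.
by apply/negP => /properP[sfg [x xg]]; rewrite -(fmax g gE sfg) xg.
Qed.

Lemma CER_signed_sum_ge0 z e S : CER z -> e \in Emax E -> S \subset e ->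
  0 <= signed_sum (zval z) S (e :\: S).
Proof.
move=> Pz eE sSe; have := Pz e (e :\: S) eE (subsetDl _ _).
by rewrite eval_altsum setDDr setDv set0U (setIidPr sSe).
Qed.

(** Below a maximal edge [e], switching permutes the masses of single sets: that of [S] becomes that
    of the symmetric difference of [S] and [e :&: U]. *)
Lemma CER_switch_point U z : CER z -> CER (switch_point U z).
Proof.
move=> Pz e W eE sWe; have eEE : e \in E by move: eE; rewrite inE => /andP[].
rewrite eval_altsum (@eq_signed_sum _ _ _
  (fun p => signed_sum (zval z) (p :\: U) (p :&: U))); last first.
  move=> p sp; apply: (zval_switch _ _ _ eEE).
  by rewrite (subset_trans sp) // subUset subsetDl.
have dW : [disjoint e :\: W & W].
  by rewrite disjoints_subset subDset setUCr subsetT.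
rewrite signed_sum_switch //.
apply: (signed_sum_ge0 (fun S => CER_signed_sum_ge0 Pz eE)).
  rewrite disjoints_subset; apply/subsetP => x; rewrite !inE.
  by case: (x \in U); case: (x \in W); case: (x \in e).
apply/subsetP => x; rewrite !inE; have := subsetP sWe x.
by case: (x \in W) => [->|_]; case: (x \in e); rewrite ?andbF ?andbT.
Qed.

(** * Integrality of the forms involved *)

Definition integral f : Prop :=
  (forall p, f.1 p \is a Num.int) /\ f.2 \is a Num.int.

Lemma integralD f g : integral f -> integral g -> integral (f + g).
Proof.
move=> [f1 f2] [g1 g2]; split=> [p|]; last exact: rpredD.
by rewrite ffunE rpredD.
Qed.

Lemma integralN f : integral f -> integral (- f).
Proof.
by move=> [f1 f2]; split=> [p|]; rewrite ?ffunE rpredN.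
Qed.

Lemma integral_acst (c : R) : c \is a Num.int -> integral (acst E c).
Proof. by move=> cint; split=> [p|//]; rewrite ffunE rpred0. Qed.

Lemma integral_avar p : integral (avar R p).
Proof. by split=> [q|]; rewrite ?ffunE ?rpred_nat ?rpred0. Qed.

Lemma integral_sum (I : finType) (P : pred I) (F : I -> affine R E) :
  (forall i, P i -> integral (F i)) -> integral (\sum_(i | P i) F i).
Proof.
move=> intF; apply: (big_ind integral) => //; last exact: integralD.
exact: (integral_acst (rpred0 _)).
Qed.

Lemma integral_zform p : integral (zform R E p).
Proof.
rewrite /zform; case: ifP => _; first exact: (integral_acst (rpred1 _)).
case: pickP => [v _|_]; first exact: integral_avar.
case: insub => [e|]; first exact: integral_avar.
exact: (integral_acst (rpred0 _)).
Qed.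

Lemma integral_altsum A B : integral (altsum R E A B).
Proof.
apply: integralD; last apply: integralN;
  by apply: integral_sum => W _; apply: integral_zform.
Qed.

Lemma integral_phi U p : integral (phi R U p).
Proof.
case: p => [v|e] /=; last exact: integral_altsum.
case: ifP => _; last exact: integral_avar.
apply: integralD; first exact: (integral_acst (rpred1 _)).
exact/integralN/integral_avar.
Qed.

(** * Chvátal-Gomory cuts: invariance under switching and rounding *)

Lemma dot_switching U (I : ineq R E) z :
  dot (lhs (switching U I)) z =
  dot (lhs I) (switch_point U z) - \sum_p lhs I p * (phi R U p).2.
Proof.
have -> : dot (lhs I) (switch_point U z) =
    \sum_p lhs I p * dot (phi R U p).1 z + \sum_p lhs I p * (phi R U p).2.
  by rewrite /dot -big_split; apply: eq_bigr => p _; rewrite ffunE mulrDr.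
rewrite addrK /dot /=.
transitivity (\sum_q \sum_p lhs I p * ((phi R U p).1 q * z q)).
  apply: eq_bigr => q _; rewrite ffunE mulr_suml.
  by apply: eq_bigr => p _; rewrite mulrA.
by rewrite exchange_big; apply: eq_bigr => p _; rewrite mulr_sumr.
Qed.

Lemma CG_cut_switching U (I : ineq R E) :
  CG_cut (@CER R V E) I -> CG_cut (@CER R V E) (switching U I).
Proof.
move=> [intI [beta [rhsI leI]]].
have intc : \sum_p lhs I p * (phi R U p).2 \is a Num.int.
  by apply: rpred_sum => p _; rewrite rpredM //; have [] := integral_phi U p.
split=> [q|].
  rewrite ffunE rpred_sum // => p _; rewrite rpredM //.
  by have [] := integral_phi U p.
(* The bound is translated by the constants that switching moves to the right; their sum is an
   integer, so rounding down commutes with the translation. *)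
exists (beta - \sum_p lhs I p * (phi R U p).2); split=> [|z Pz].
  rewrite floorDrz ?rpredN //= rhsI intrD; congr (_ + _).
  by rewrite floorK ?rpredN.
by rewrite dot_switching lerD2r leI //; apply: CER_switch_point.
Qed.

Lemma CG_cut_half (P : point R E -> Prop) f g :
    integral f -> integral g ->
    (forall z, P z -> eval f z - eval g z <= 2^-1) ->
  CG_cut P (ineq_of f g).
Proof.
move=> intf intg le_fg; have [fg1 fg2] := integralD intf (integralN intg).
split=> [p|]; first exact: fg1.
(* An integer plus 1/2 rounds down to that integer, the right-hand side of [ineq_of f g]. *)
exists (g.2 - f.2 + 2^-1); split=> [|z /le_fg]; last first.
  rewrite -evalN -evalD /eval /= => le; lra.
have int_gf : g.2 - f.2 \is a Num.int by rewrite -opprB rpredN.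
rewrite floorDzr // intrD floorK //= (_ : Num.floor _ = 0) ?addr0 //.
by apply: floor_def; rewrite add0r; lra.
Qed.

(** * Half-integral bounds on the excess for three edges *)

Section EdgeMoments.

Variables (z : point R E) (Pz : CER z).
Implicit Types X Y e : {set V}.

Lemma zval_anti e X Y : e \in E -> X \subset Y -> Y \subset e ->
  zval z Y <= zval z X.
Proof.
move=> /Emax_above[f fE sef] sXY sYe.
apply: (moment_anti (fun S => CER_signed_sum_ge0 Pz fE) sXY).
exact: subset_trans sYe sef.
Qed.

Lemma zval_supermod e X Y : e \in E -> X \subset e -> Y \subset e ->
  zval z X + zval z Y <= zval z (X :&: Y) + zval z (X :|: Y).
Proof.
move=> /Emax_above[f fE sef] sXe sYe.
by apply: (moment_supermod (fun S => CER_signed_sum_ge0 Pz fE));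
   apply: subset_trans sef.
Qed.

Lemma zval_le1 e X : e \in E -> X \subset e -> zval z X <= 1.
Proof.
move=> eE sXe; apply: le_trans (zval_anti eE (sub0set X) sXe) _.
by rewrite /zval zform0 eval_acst.
Qed.

Lemma zval_ge0 e : e \in E -> 0 <= zval z e.
Proof.
move=> /Emax_above[f fE sef]; rewrite -(signed_sum0 (zval z) e).
apply: (signed_sum_ge0 (fun S => CER_signed_sum_ge0 Pz fE)).
  by rewrite disjoint_sym disjoints_subset sub0set.
by rewrite setU0.
Qed.

(** Write z12 for the value at [e1 :&: e2], and so on. As [e3] is the union of its traces on [e1]
    and [e2], z1 + z2 <= z13 + z23 <= z123 + z3. Adding z1 + z2 <= 2 z12 bounds twice the excess by
    z123 - z3 <= 1. *)
Lemma zval_two_edges e1 e2 e3 : e1 \in E -> e2 \in E -> e3 \in E ->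
    e3 \subset e1 :|: e2 ->
  zval z e1 + zval z e2 - (zval z (e1 :&: e2) + zval z e3) <= 2^-1.
Proof.
move=> e1E e2E e3E s3.
have := zval_supermod e3E (subsetIr e1 e3) (subsetIr e2 e3).
rewrite -setIUl (setIidPr s3).
have := zval_anti e1E (subsetIl e1 e2) (subxx _).
have := zval_anti e1E (subsetIl e1 e3) (subxx _).
have := zval_anti e2E (subsetIr e1 e2) (subxx _).
have := zval_anti e2E (subsetIl e2 e3) (subxx _).
have := zval_ge0 e3E.
have : zval z (e1 :&: e3 :&: (e2 :&: e3)) <= 1.
  by apply: (zval_le1 e3E); rewrite setIA subsetIr.
lra.
Qed.

(** Each edge is the union of its two pairwise intersections, so supermodularity gives z12 + z13 <=
    z123 + z1 and its two analogues. Their sum bounds twice the excess by z123 - z1 - z2 - z3 <=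
    1. *)
Lemma zval_three_caps e1 e2 e3 : e1 \in E -> e2 \in E -> e3 \in E ->
    e1 \subset e2 :|: e3 -> e2 \subset e1 :|: e3 -> e3 \subset e1 :|: e2 ->
  zval z (e1 :&: e2) + zval z (e1 :&: e3) + zval z (e2 :&: e3)
    - zval z e1 - zval z e2 - zval z e3 - zval z (e1 :&: e2 :&: e3) <= 2^-1.
Proof.
move=> e1E e2E e3E s1 s2 s3.
have := zval_supermod e1E (subsetIl e1 e2) (subsetIl e1 e3).
rewrite -setIUr (setIidPl s1) setIACA setIid setIA.
have := zval_supermod e2E (subsetIr e1 e2) (subsetIl e2 e3).
rewrite (setIC e1 e2) -setIUr (setIidPl s2) setIACA setIid.
rewrite (setIC e2 e1) setIA (setIC e2 e1).
have := zval_supermod e3E (subsetIr e1 e3) (subsetIr e2 e3).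
rewrite -setIUl (setIidPr s3) setIACA setIid.
have := zval_ge0 e1E; have := zval_ge0 e2E; have := zval_ge0 e3E.
have : zval z (e1 :&: e2 :&: e3) <= 1 by apply: (zval_le1 e3E) (subsetIr _ _).
lra.
Qed.

End EdgeMoments.

End AffineForms.


Theorem proposition8 (R : realType) (V : finType) (E : {set {set V}})
    (e1 e2 e3 : {set V})
    (hE : hypergraph E) (hcl : E = cl E)
    (hC : alpha_cycle E [tuple e1; e2; e3])
    (h1 : e1 :\: (e2 :|: e3) = set0)
    (h2 : e2 :\: (e1 :|: e3) = set0)
    (h3 : e3 :\: (e1 :|: e2) = set0) :
  let z := @zform R V E in
  forall U : {set V},
  [/\ CG_cut (@CER R V E)
        (switching U (ineq_of (z e1 + z e2) (z (e1 :&: e2) + z e3))),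
      CG_cut (@CER R V E)
        (switching U (ineq_of (z e1 + z e3) (z (e1 :&: e3) + z e2))),
      CG_cut (@CER R V E)
        (switching U (ineq_of (z e2 + z e3) (z (e2 :&: e3) + z e1)))
    & CG_cut (@CER R V E)
        (switching U
          (ineq_of (z (e1 :&: e2) + z (e1 :&: e3) + z (e2 :&: e3)
                      - z e1 - z e2 - z e3)
                   (z (e1 :&: e2 :&: e3))))].
Proof.
move=> z U.
have [_ CE _ _] := hC.
have e1E : e1 \in E := CE 0.
have e2E : e2 \in E := CE 1.
have e3E : e3 \in E := CE ord_max.
move/eqP: h1 h2 h3; rewrite setD_eq0 => s1.
move=> /eqP; rewrite setD_eq0 => s2 /eqP; rewrite setD_eq0 => s3.
have intz p : integral (z p) := integral_zform R E p.
(* Switching is stripped first, which leaves only the bound 1/2 on the excess of each unswitched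
   inequality. *)
split; apply/CG_cut_switching/CG_cut_half;
  do ?[exact: intz | apply: integralD | apply: integralN];
  move=> x Px; rewrite !(evalD, evalN).
- exact: zval_two_edges.
- exact: zval_two_edges.
- by apply: zval_two_edges; rewrite // setUC.
- exact: zval_three_caps.
Qed.
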